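(* Let $P\in\mathbb{F}_{q^r}[X,\sigma]$ be a monic polynomial. The degrees (with multiplicity) of the factors in a factorization of $P$ as a product of irreducible polynomials in $\mathbb{F}_{q^r}[X,\sigma]$ are the same as the degrees of the factors of $\Psi(P)$ in a factorization as a product of irreducible polynomials in $\mathbb{F}_q[Y]$.
   Context: Let $p$ be a prime, $q=p^a$, $r\ge1$, $\sigma(x)=x^q$ on $\mathbb{F}_{q^r}$. $\mathbb{F}_{q^r}[X,\sigma]$ is the skew polynomial ring with $X\cdot c=\sigma(c)\cdot X$ for $c\in\mathbb{F}_{q^r}$. For monic $P=X^d-\sum_{i=0}^{d-1}a_iX^i$, let $D_P=\bigoplus_{i=0}^{d-1}\mathbb{F}_{q^r}e_i$ with the $\sigma$-semi-linear map $\varphi$ given by $\varphi(e_i)=e_{i+1}$ for $0\le i\le d-2$ and $\varphi(e_{d-1})=\sum_{i=0}^{d-1}a_ie_i$. Then $\varphi^r$ is $\mathbb{F}_{q^r}$-linear, and $\Psi(P)=\det(Y\,\mathrm{id}-\varphi^r)$, its characteristic polynomial, which lies in $\mathbb{F}_q[Y]$ (commutative polynomials). *)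

(* Defs.v *)
From HB Require Import structures.
From mathcomp Require Import all_boot all_order all_fingroup all_algebra all_field.

Set Implicit Arguments.
Unset Strict Implicit.
Unset Printing Implicit Defensive.

Import GRing.Theory.
Local Open Scope ring_scope.

(* The skew polynomial ring R[X, s], with X * c = s(c) * X.  Its elements are
   the left-coefficient sums \sum_i c_i X^i, so the carrier, the addition, the
   coefficients and the degree are those of {poly R}; only the product is
   twisted.  The argument s is a phantom that selects this product. *)
Definition skewpoly (R : nzRingType) (s : {rmorphism R -> R}) : Type := {poly R}.

HB.instance Definition _ (R : nzRingType) (s : {rmorphism R -> R}) :=
  GRing.Zmodule.copy (skewpoly s) {poly R}.

Section SkewPoly.
Variables (R : nzRingType) (s : {rmorphism R -> R}).
Implicit Types p q r : {poly R}.

(* (\sum_i a_i X^i) (\sum_j b_j X^j) = \sum_(i, j) a_i s^i(b_j) X^(i + j) *)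
Definition mul_skew p q : {poly R} :=
  \poly_(k < (size p + size q).-1)
    (\sum_(i < k.+1) p`_i * iter i s q`_(k - i)).

Let iter_s0 i : iter i s 0 = 0.
Proof. by elim: i => //= i ->; rewrite rmorph0. Qed.

Let iter_s1 i : iter i s 1 = 1.
Proof. by elim: i => //= i ->; rewrite rmorph1. Qed.

Let iter_sD i x y : iter i s (x + y) = iter i s x + iter i s y.
Proof. by elim: i => //= i ->; rewrite rmorphD. Qed.

Let iter_sM i x y : iter i s (x * y) = iter i s x * iter i s y.
Proof. by elim: i => //= i ->; rewrite rmorphM. Qed.

Let iter_s_sum i n (E : 'I_n -> R) (P : pred 'I_n) :
  iter i s (\sum_(j | P j) E j) = \sum_(j | P j) iter i s (E j).
Proof. by elim: i => //= i ->; rewrite rmorph_sum. Qed.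

Lemma coef_mul_skew p q k :
  (mul_skew p q)`_k = \sum_(i < k.+1) p`_i * iter i s q`_(k - i).
Proof.
rewrite coef_poly ltn_predRL; case: leqP => // le_pq_i1.
rewrite big1 // => j _; have [lq_p_j|lt_j_p] := leqP (size p) j.
  by rewrite nth_default ?mul0r.
rewrite [q`__]nth_default ?iter_s0 ?mulr0 // leq_subRL -ltnS //.
by rewrite (leq_trans _ le_pq_i1) // ltn_add2r.
Qed.

Fact coef_mul_skew_rev p q i :
  (mul_skew p q)`_i = \sum_(j < i.+1) p`_(i - j) * iter (i - j) s q`_j.
Proof.
rewrite coef_mul_skew (reindex_inj rev_ord_inj) /=.
by apply: eq_bigr => j _; rewrite subSS (sub_ordK j).
Qed.

Fact mul_skewA : associative mul_skew.
Proof.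
move=> p q r; apply/polyP=> i; rewrite coef_mul_skew coef_mul_skew_rev.
pose coef3 j k := p`_j * (iter j s q`_(i - j - k) * iter (i - k) s r`_k).
transitivity (\sum_(j < i.+1) \sum_(k < i.+1 | (k <= i - j)%N) coef3 j k).
  apply: eq_bigr => /= j _; rewrite coef_mul_skew_rev iter_s_sum big_distrr /=.
  rewrite (big_ord_narrow_leq (leq_subr _ _)); apply: eq_bigr => k _ /=.
  rewrite /coef3 iter_sM -iterD subnAC subnKC // leq_subRL ?leq_ord //.
    by rewrite addnC -leq_subRL ?leq_ord // -ltnS.
  by rewrite (leq_trans (leq_ord k)) // leq_subr.
rewrite (exchange_big_dep predT) //=; apply: eq_bigr => k _.
transitivity (\sum_(j < i.+1 | (j <= i - k)%N) coef3 j k).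
  apply: eq_bigl => j; rewrite -ltnS -(ltnS j) -!subSn ?leq_ord //.
  by rewrite -subn_gt0 -(subn_gt0 j) -!subnDA addnC.
rewrite (big_ord_narrow_leq (leq_subr _ _)) coef_mul_skew big_distrl /=.
by apply: eq_bigr => j _; rewrite /coef3 -!subnDA addnC mulrA.
Qed.

Fact mul_1skew : left_id 1%:P mul_skew.
Proof.
move=> p; apply/polyP => i; rewrite coef_mul_skew big_ord_recl subn0 /=.
by rewrite big1 => [|j _]; rewrite coefC ?mul1r ?addr0 ?mul0r.
Qed.

Fact mul_skew1 : right_id 1%:P mul_skew.
Proof.
move=> p; apply/polyP => i; rewrite coef_mul_skew_rev big_ord_recl subn0 /=.
by rewrite big1 => [|j _]; rewrite coefC ?iter_s0 ?iter_s1 ?mulr1 ?addr0 ?mulr0.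
Qed.

Fact mul_skewDl : left_distributive mul_skew +%R.
Proof.
move=> p q r; apply/polyP=> i; rewrite coefD !coef_mul_skew -big_split.
by apply: eq_bigr => j _; rewrite coefD mulrDl.
Qed.

Fact mul_skewDr : right_distributive mul_skew +%R.
Proof.
move=> p q r; apply/polyP=> i; rewrite coefD !coef_mul_skew -big_split.
by apply: eq_bigr => j _; rewrite coefD iter_sD mulrDr.
Qed.

Fact skew1_neq0 : 1%:P != 0 :> {poly R}.
Proof. by rewrite polyC_eq0 oner_neq0. Qed.

HB.instance Definition _ := GRing.Zmodule_isNzRing.Build (skewpoly s)
  mul_skewA mul_1skew mul_skew1 mul_skewDl mul_skewDr skew1_neq0.

Lemma skew_commXC (c : R) :
  ('X : skewpoly s) * (c%:P : skewpoly s)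
    = ((s c)%:P : skewpoly s) * ('X : skewpoly s).
Proof.
apply/polyP => -[|k].
  by rewrite !coef_mul_skew !big_ord1 !coefX /= mul0r mulr0.
rewrite !coef_mul_skew !(big_ord_recl k.+1) !coefX /= mul0r add0r.
rewrite big_ord_recl !coefX coefC /= mul1r !big1 => [|i _|i _].
- by rewrite coefC; case: k => [|k] /=; rewrite ?rmorph0 ?mulr0 ?mulr1.
- by rewrite coefC mul0r.
by rewrite coefX mul0r.
Qed.

End SkewPoly.

(* Degree of a skew or an ordinary polynomial (with the convention deg 0 = 0). *)
Definition deg (R : nzRingType) (p : {poly R}) : nat := (size p).-1.

Definition is_unit (R : nzRingType) (x : R) : Prop :=
  exists y : R, y * x = 1 /\ x * y = 1.

Definition irreducible_elt (R : nzRingType) (x : R) : Prop :=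
  ~ is_unit x /\ forall y z : R, x = y * z -> is_unit y \/ is_unit z.

Section Psi.
(* F is F_q, L is F_(q^r) with r = \dim {:L}. *)
Variables (F : finFieldType) (L : fieldExtType F).

Definition sigma (x : L) : L := x ^+ #|F|.

Fact sigma_is_zmod_morphism : zmod_morphism sigma.
Proof.
have [p pr_p pcF] := finPcharP F.
have pcL : p \in [pchar L] by rewrite pchar_lalg.
have qnat : [pchar L].-nat #|F|.
  by rewrite (eq_pnat _ (pcharf_eq pcL)) (card_pprimeChar pcF) pnatX pnat_id.
move=> x y; rewrite /sigma exprDn_pchar // exprNn_pchar //.
Qed.

Fact sigma_is_monoid_morphism : monoid_morphism sigma.
Proof. by split=> [|x y]; rewrite /sigma ?expr1n ?exprMn. Qed.

HB.instance Definition _ :=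
  GRing.isZmodMorphism.Build L L sigma sigma_is_zmod_morphism.
HB.instance Definition _ :=
  GRing.isMonoidMorphism.Build L L sigma sigma_is_monoid_morphism.

(* D_P = L^d with d = deg P, written as row vectors in the basis (e_i). *)
Section DP.
Variable P : skewpoly sigma.
Local Notation d := (deg P).

(* phi(e_i); since P = X^d - \sum_j a_j X^j, one has a_j = - P_j for j < d. *)
Definition phi_basis (i : 'I_d) : 'rV[L]_d :=
  if (i.+1 < d)%N then \row_j ((j == i.+1 :> nat)%:R)
  else \row_j (- (P : {poly L})`_j).

Definition phi (v : 'rV[L]_d) : 'rV[L]_d :=
  \sum_i sigma (v 0 i) *: phi_basis i.

Definition phi_r : 'rV[L]_d -> 'rV[L]_d := iter (\dim {:L}) phi.

(* det (Y id - phi^r), with coefficients in L; lin1_mx phi_r is the matrix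
   whose i-th row is phi^r(e_i), see phi_r_mxE. *)
Definition PsiL : {poly L} := char_poly (lin1_mx phi_r).

End DP.

Definition descend (x : L) : F := odflt 0 [pick c : F | c%:A == x].

(* Psi(P) as an element of F_q[Y]: the polynomial over F whose image over L is
   PsiL P, see map_Psi. *)
Definition Psi (P : skewpoly sigma) : {poly F} := map_poly descend (PsiL P).

Lemma descendE (x : L) : sigma x = x -> (descend x)%:A = x.
Proof.
move=> xFx; rewrite /descend; case: pickP => [c /eqP //|/= no_c].
pose q : {poly L} := map_poly (in_alg L) ('X^#|F| - 'X).
have: root q x.
  rewrite /q rmorphB /= map_polyXn map_polyX.
  by rewrite rootE !(hornerE, hornerXn) [x ^+ _]xFx subrr.
have -> : q = \prod_(z <- [seq b%:A | b : F]) ('X - z%:P).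
  rewrite /q finField_genPoly rmorph_prod big_image /=.
  by apply: eq_bigr => b _; rewrite rmorphB /= map_polyX map_polyC.
by rewrite root_prod_XsubC => /mapP[a _ xa]; have := no_c a; rewrite xa eqxx.
Qed.

Fact iter_sigmaE k (x : L) : iter k sigma x = x ^+ (#|F| ^ k).
Proof.
by elim: k => [|k IHk] //=; rewrite IHk /sigma -exprM expnSr.
Qed.

Fact iter_sigma_id (x : L) : iter (\dim {:L}) sigma x = x.
Proof.
rewrite iter_sigmaE; pose L' := FinFieldExtType L.
have <- : #|L'| = (#|F| ^ \dim {:L})%N.
  by rewrite -(@card_vspace F (finvect_type L) _ fullv) card_vspacef.
exact: (expf_card (x : L')).
Qed.

Fact char_poly_mulC n (A B : 'M[L]_n) : char_poly (A *m B) = char_poly (B *m A).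
Proof.
pose A' : 'M[{poly L}]_n := map_mx polyC A.
pose B' : 'M[{poly L}]_n := map_mx polyC B.
pose D := \det (block_mx 'X%:M A' B' 1%:M).
have D1 : D = char_poly (A *m B).
  have : D * \det (block_mx (1%:M : 'M[{poly L}]_n) 0 (- B') (1%:M : 'M_n))
           = char_poly (A *m B).
    rewrite -det_mulmx mulmx_block !mulmx1 !mulmx0 !mul1mx !mulmxN !add0r subrr.
    rewrite det_ublock det1 mulr1 /char_poly /char_poly_mx map_mxM //.
  by rewrite det_lblock !det1 !mulr1.
have D2 : \det ('X%:M : 'M[{poly L}]_n) * D
            = \det ('X%:M : 'M[{poly L}]_n) * char_poly (B *m A).
  have : \det (block_mx (1%:M : 'M[{poly L}]_n) 0 (- B') ('X%:M : 'M_n)) * D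
           = \det ('X%:M : 'M[{poly L}]_n) * char_poly (B *m A).
    rewrite -det_mulmx mulmx_block !mul1mx !mul0mx !addr0.
    rewrite mulNmx -scalar_mxC addNr mulmx1.
    by rewrite det_ublock /char_poly /char_poly_mx map_mxM // mulNmx addrC.
  by rewrite det_lblock det1 mul1r.
rewrite -D1; apply: (mulfI _ D2).
by rewrite det_scalar expf_neq0 // polyX_eq0.
Qed.

Section Descent.
Variable P : skewpoly sigma.
Local Notation d := (deg P).

Let A : 'M[L]_d := \matrix_i phi_basis i.
Let M k : 'M[L]_d := iter k (fun B => map_mx sigma B *m A) 1%:M.

Fact phi_mxE (v : 'rV[L]_d) : phi v = map_mx sigma v *m A.
Proof.
by rewrite mulmx_sum_row; apply: eq_bigr => i _; rewrite !mxE rowK.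
Qed.

Let iter_phi_mxE k (v : 'rV[L]_d) :
  iter k (@phi P) v = map_mx (iter k sigma) v *m M k.
Proof.
elim: k => [|k IHk]; first by rewrite mulmx1 map_mx_id.
by rewrite /= IHk phi_mxE map_mxM -mulmxA -map_mx_comp.
Qed.

Let phi_r_M : lin1_mx (@phi_r P) = M (\dim {:L}).
Proof.
apply/matrixP=> i j; rewrite mxE /phi_r iter_phi_mxE map_mx_id.
  by rewrite -rowE mxE.
exact: iter_sigma_id.
Qed.

Let M_Sl k : M k.+1 = map_mx (iter k sigma) A *m M k.
Proof.
elim: k => [|k IHk]; first by rewrite /M /= map_mx1 mul1mx mulmx1 map_mx_id.
have MS n : M n.+1 = map_mx sigma (M n) *m A by [].
by rewrite (MS k.+1) {1}IHk map_mxM -mulmxA -MS -map_mx_comp.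
Qed.

Lemma phi_r_mxE (v : 'rV[L]_d) : phi_r v = v *m lin1_mx (@phi_r P).
Proof.
by rewrite phi_r_M /phi_r iter_phi_mxE map_mx_id //; apply: iter_sigma_id.
Qed.

Lemma sigma_PsiL : map_poly sigma (PsiL P) = PsiL P.
Proof.
rewrite /PsiL map_char_poly phi_r_M.
have rE : \dim {:L} = (\dim {:L}).-1.+1 by rewrite prednK ?adim_gt0.
have {2}-> : M (\dim {:L}) = map_mx sigma (M (\dim {:L}).-1) *m A.
  by rewrite [in LHS]rE.
rewrite char_poly_mulC; congr char_poly.
rewrite {1}rE M_Sl map_mxM -map_mx_comp; congr (_ *m _).
apply/matrixP=> i j; rewrite mxE; rewrite -[RHS]iter_sigma_id [in RHS]rE.
by [].
Qed.

Lemma map_Psi : map_poly (in_alg L) (Psi P) = PsiL P.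
Proof.
have desc0 : descend 0 = 0.
  apply: (fmorph_inj (in_alg L)); rewrite rmorph0 /=.
  by apply: descendE; rewrite rmorph0.
apply/polyP=> i; rewrite coef_map /= coef_map_id0 // descendE //.
by rewrite -[in RHS]sigma_PsiL coef_map.
Qed.

End Descent.

End Psi.

(* Main.v *)
(** Monic skew polynomials correspond to cyclic modules D_P with a semilinear
    operator phi, and a product P Q to an extension of D_Q by D_P, so Psi is
    multiplicative (the matrix of phi becomes block triangular).  It remains to
    see that Psi(P) is irreducible when P is, that is, when D_P is simple.

    By simplicity the monic g in F_q[Y] of least degree killing phi^r is
    irreducible, and it divides Psi(P) by Cayley-Hamilton; one must show
    deg P <= deg g.  If phi v = u(phi^r) v for some v <> 0 and u in L[Y], then
    L[phi^r] v is stable, hence everything, and it has dimension at most deg g.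
    When phi is not injective, take u = 0.  Otherwise Y is invertible modulo g,
    and the norm from (L[Y]/g)^* to (F_q[Y]/g)^* is onto (Hilbert 90 and a
    cardinality count), so Y^-1 is the norm of some w modulo g.  Then
    psi = w(phi^r) phi is semilinear with psi^r = 1, and the sum over i < r of
    psi^i(b e) is fixed by psi, and nonzero for some b in L by independence of
    the powers of sigma; this vector is the required v. *)

From HB Require Import structures.
Require Import Defs.
From mathcomp Require Import all_boot all_order all_fingroup all_algebra all_field.

Set Implicit Arguments.
Unset Strict Implicit.
Unset Printing Implicit Defensive.

Import GRing.Theory.
Local Open Scope ring_scope.

(** * Norms modulo a polynomial *)

Section HerbrandQuotient.
Local Open Scope group_scope.
Variables (gT : finGroupType) (s : gT -> gT) (r : nat).
Hypothesis mulC : forall x y : gT, x * y = y * x.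
Hypothesis sM : {morph s : x y / x * y}.

(* With T x = x / s x, the inclusions ker N <= im T and im N <= ker T force
   im N = ker T, because |im N| |ker N| = |im T| |ker T|. *)
Lemma group_norm_onto :
    (forall x, iter r s x = x) ->
    (forall u, \prod_(i < r) iter i s u = 1 -> exists w, u = w * (s w)^-1) ->
  forall y, s y = y -> exists u, \prod_(i < r) iter i s u = y.
Proof.
move=> s_r H90 y sy.
have s1 : s 1 = 1 by apply: (mulgI (s 1)); rewrite -sM !mulg1.
have itM i : {morph iter i s : x z / x * z}.
  by elim: i => [|i IHi] x z //=; rewrite IHi sM.
pose N x := \prod_(i < r) iter i s x.
have sN x : s (N x) = N x.
  rewrite /N (big_morph s sM s1); case: (r) (s_r) => [|n] s_n; first by rewrite !big_ord0.
  rewrite big_ord_recr big_ord_recl /= -[s (iter n s x)]/(iter n.+1 s x) s_n mulC.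
  by congr (_ * _).
have NM : {in [set: gT] &, {morph N : x z / x * z}}.
  move=> x z _ _; rewrite /N; elim: (r) => [|n IHn]; first by rewrite !big_ord0 mulg1.
  rewrite !big_ord_recr /= IHn itM -!mulgA; congr (_ * _).
  by rewrite !mulgA; congr (_ * _); apply: mulC.
pose T x := x * (s x)^-1.
have TM : {in [set: gT] &, {morph T : x z / x * z}}.
  move=> x z _ _; rewrite /T sM invMg -!mulgA; congr (_ * _).
  by rewrite [RHS]mulC -mulgA.
pose fN := Morphism NM; pose fT := Morphism TM.
have cardf (f : {morphism [set: gT] >-> gT}) :
    (#|f @* [set: gT]| * #|'ker f| = #|[set: gT]|)%N.
  by rewrite card_morphim setIid mulnC Lagrange // subsetIl.
have kerN_sub : 'ker fN \subset fT @* [set: gT].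
  apply/subsetP=> u /mker /= /H90[w ->].
  by rewrite (mem_morphim fT) // inE.
have imN_sub : fN @* [set: gT] \subset 'ker fT.
  apply/subsetP=> _ /morphimP[x _ _ ->].
  by rewrite !inE /= /T sN mulgV.
have leT : (#|'ker fT| <= #|fN @* [set: gT]|)%N.
  rewrite -(leq_pmul2r (cardG_gt0 ('ker fN)%G)) cardf -(cardf fT) mulnC.
  by rewrite leq_mul2r subset_leq_card // orbT.
have /eqP eqNT : fN @* [set: gT] == 'ker fT by rewrite eqEcard imN_sub.
have : y \in 'ker fT by rewrite !inE /= /T sy mulgV.
by rewrite -eqNT => /morphimP[u _ _ ->]; exists u.
Qed.

End HerbrandQuotient.

Section NormModulo.
Variables (K : finFieldType) (s : {rmorphism K -> K}) (r : nat).
Hypothesis s_r : forall x, iter r s x = x.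
(** Independence of the powers of [s], stated for the coefficient of the identity alone: it is
    applied where that coefficient comes from [cU 0 = 1]. *)
Hypothesis artin : forall c : nat -> K,
  (forall b, \sum_(i < r) c i * iter i s b = 0) -> c 0%N = 0.

Variable g : {poly K}.
Hypothesis g_monic : g \is monic.
Hypothesis g_gt1 : (1 < size g)%N.
Hypothesis gs : map_poly s g = g.
(** [g] may still factor over [K]: only proper divisors fixed by [s] are excluded, as for an
    irreducible polynomial over the fixed field. *)
Hypothesis g_irr : forall h : {poly K},
  h \is monic -> map_poly s h = h -> h %| g -> h = 1 \/ h = g.

Local Notation S := (map_poly s).
Local Notation N u := (\prod_(i < r) iter i S u).

(* Hilbert 90 for K[Y]/(g): the sum w below satisfies u * S w = w mod g, so
   gcd(w, g) is S-stable and, w being nonzero, trivial. *)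
Lemma hilbert90_modulo (u : {poly K}) : g %| N u - 1 ->
  exists w, coprimep w g /\ g %| u * S w - w.
Proof.
move=> Nu1; pose cU i := \prod_(j < i) iter j S u.
have cUS i : u * S (cU i) = cU i.+1.
  by rewrite /cU big_ord_recl /= rmorph_prod.
pose w b := \sum_(i < r) iter i s b *: cU i.
(* [u * S] sends each summand of [w b] to the next one, so the difference telescopes; [s_r]
   identifies the two ends. *)
have wS b : g %| u * S (w b) - w b.
  suff ->: u * S (w b) - w b = b *: (N u - 1) by rewrite -mul_polyC dvdp_mull.
  rewrite /w rmorph_sum mulr_sumr -sumrB.
  rewrite (eq_bigr (fun i : 'I_r =>
      iter i.+1 s b *: cU i.+1 - iter i s b *: cU i)); last first.
    by move=> i _; rewrite /= map_polyZ -scalerAr cUS.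
  rewrite -(big_mkord xpredT (fun i => iter i.+1 s b *: cU i.+1 - iter i s b *: cU i)).
  rewrite telescope_sumr // s_r /= /cU big_ord0.
  by rewrite scalerBr.
(* Otherwise the constant coefficients of the [cU i %% g] would give a linear relation among the
   powers of [s], but the one at i = 0 is 1 since [g] has positive degree. *)
have [b wb] : exists b, ~~ (g %| w b).
  apply/existsP; apply/existsPn => /= dvd_w.
  have /eqP : (cU 0%N %% g)`_0 = 0.
    apply: (artin (c := fun i => (cU i %% g)`_0)) => b.
    have := dvd_w b; rewrite negbK => /modp_eq0P.
    rewrite /w (big_morph (fun p => p %% g) (id1 := 0) (op1 := +%R)); first last.
    - by rewrite mod0p.
    - by move=> p q; rewrite modpD.
    move/(congr1 (fun p : {poly K} => p`_0)); rewrite coef0 coef_sum => e0.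
    rewrite -[RHS]e0; by apply: eq_bigr => i _; rewrite modpZl coefZ mulrC.
  by rewrite /cU big_ord0 modp_small ?size_poly1 // coef1 oner_eq0.
exists (w b); split=> //; set h0 := gcdp (w b) g.
have g0 : g != 0 by apply: monic_neq0.
have h0_neq0 : h0 != 0 by rewrite gcdp_eq0 (negPf g0) andbF.
pose h := (lead_coef h0)^-1 *: h0.
have lc0 : (lead_coef h0)^-1 != 0 by rewrite invr_eq0 lead_coef_eq0.
have hh0 : h %= h0 by apply: eqp_scale.
have hm : h \is monic by rewrite monicE lead_coefZ mulVf // lead_coef_eq0.
(* [S h0] divides [S (w b)] and [g], hence also [w b], which differs from [u * S (w b)] by a
   multiple of [g]. *)
have Sh0 : S h0 %| h0.
  have h0g : S h0 %| g by rewrite -[g in _ %| g]gs dvdp_map dvdp_gcdr.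
  rewrite dvdp_gcd h0g andbT -(dvdp_addr _ (dvdp_trans h0g (wS b))) subrK.
  by rewrite dvdp_mull // dvdp_map dvdp_gcdl.
have Sh : S h = h.
  apply/eqP; rewrite -eqp_monic ?map_monic //.
  rewrite -dvdp_size_eqp ?size_map_poly //.
  by rewrite (eqp_dvdr _ hh0) map_polyZ dvdpZl // fmorph_eq0.
have hg : h %| g by rewrite (eqp_dvdl _ hh0) dvdp_gcdr.
have [h1|hg1] := g_irr hm Sh hg.
  by rewrite /coprimep -/h0 -(eqp_size hh0) h1 size_poly1.
by case/negP: wb; rewrite -{1}hg1 (eqp_dvdl _ hh0) dvdp_gcdl.
Qed.

Lemma in_qpoly_eq (a b : {poly K}) : (in_qpoly g a == in_qpoly g b) = (g %| a - b).
Proof.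
have mg : mk_monic g = g by rewrite /mk_monic g_gt1 g_monic.
rewrite -val_eqE /= mg -!Pdiv.IdomainMonic.modpE //.
by rewrite -subr_eq0 -modpN -modpD.
Qed.

Lemma in_qpolyK (x : {poly %/ g}) : in_qpoly g x = x.
Proof. exact/val_inj/in_qpoly_small/size_mk_monic. Qed.

(** The group statement is applied to the units of the finite ring K[Y]/(g) with the map induced by
    [S]; [hilbert90_modulo] supplies its second hypothesis. The fixed element shown to be a norm is
    the inverse of [y]. *)
Lemma norm_onto_modulo (y : {poly K}) :
  S y = y -> coprimep y g -> exists u, g %| N u * y - 1.
Proof.
move=> Sy cyg; pose Q := {poly %/ g}.
pose sQ (x : Q) : Q := in_qpoly g (S x).
have sQE a : sQ (in_qpoly g a) = in_qpoly g (S a).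
  apply/eqP; rewrite in_qpoly_eq -rmorphB -[g in g %| _]gs dvdp_map.
  by rewrite -in_qpoly_eq in_qpolyK.
have itE i a : iter i sQ (in_qpoly g a) = in_qpoly g (iter i S a).
  by elim: i => //= i ->; rewrite sQE.
have sQM : {morph sQ : x z / x * z}.
  by move=> x z; rewrite -[x]in_qpolyK -[z]in_qpolyK -rmorphM !sQE !rmorphM.
have sQ1 : sQ 1 = 1 by rewrite -(rmorph1 (in_qpoly g)) sQE !rmorph1.
have sQU (x : {unit Q}) : sQ (val x) \is a GRing.unit.
  apply/unitrPr; exists (sQ (val x)^-1).
  by rewrite -sQM mulrV ?sQ1 //; apply: valP.
pose sU (x : {unit Q}) : {unit Q} := FinRing.Unit (sQU x).
have sUM : {morph sU : x z / (x * z)%g}.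
  by move=> x z; apply: val_inj; rewrite /= sQM.
have UC (x z : {unit Q}) : (x * z = z * x)%g.
  by apply: val_inj; rewrite /= mulrC.
have val_iter i (x : {unit Q}) : val (iter i sU x) = iter i sQ (val x).
  by elim: i => //= i ->.
have iterS_r a : iter r S a = a.
  apply/polyP=> k; rewrite -[RHS]s_r.
  by elim: (r) => //= n; rewrite coef_map => ->.
have valN (x : {unit Q}) a : val x = in_qpoly g a ->
    val (\prod_(i < r) iter i sU x)%g = in_qpoly g (N a).
  move=> xa; rewrite rmorph_prod.
  rewrite (big_morph val (id1 := 1) (op1 := *%R)) //.
  by apply: eq_bigr => i _; rewrite val_iter xa itE.
have unitP a : coprimep a g -> in_qpoly g a \is a GRing.unit.
  move=> /Bezout_eq1_coprimepP[[b c] /= bc1]; apply/unitrPr; exists (in_qpoly g b).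
  apply/eqP; rewrite -rmorphM -(rmorph1 (in_qpoly g)) in_qpoly_eq -bc1.
  by rewrite mulrC opprD addrA subrr add0r -mulNr dvdp_mull.
pose Y : {unit Q} := FinRing.Unit (unitP y cyg).
have H90 (u : {unit Q}) :
    (\prod_(i < r) iter i sU u = 1 -> exists w, u = w * (sU w)^-1)%g.
  move=> /(congr1 val); rewrite (valN u (val (val u))) ?in_qpolyK //= => /eqP.
  rewrite -(rmorph1 (in_qpoly g)) in_qpoly_eq => /hilbert90_modulo[w [cwg uw]].
  exists (FinRing.Unit (unitP w cwg)); apply: (canRL (mulgK _)).
  apply: val_inj; rewrite /= sQE -[val u]in_qpolyK -rmorphM.
  by apply/eqP; rewrite in_qpoly_eq.
have sUY : sU Y^-1%g = Y^-1%g.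
  have sY : sU Y = Y by apply: val_inj; rewrite /= sQE Sy.
  apply: (mulgI Y); rewrite -{1}sY -sUM !mulgV; apply: val_inj.
  by rewrite /= sQ1.
have sU_r x : iter r sU x = x.
  by apply: val_inj; rewrite val_iter -[val x]in_qpolyK itE iterS_r.
have [v vY] := group_norm_onto UC sUM sU_r H90 sUY.
exists (val (val v)); rewrite -in_qpoly_eq in_qpolyM in_qpoly1.
rewrite -(valN v (val (val v))) ?in_qpolyK //.
by rewrite vY -[in_qpoly g y]/(val Y) -FinRing.val_unitM mulVg.
Qed.

End NormModulo.

(** * Skew polynomials and the modules D_P *)

Section SkewPolyTheory.
Variables (K : fieldType) (s : {rmorphism K -> K}).
Implicit Types p q : skewpoly s.

Lemma skewpoly_mulC (c : K) p : (c%:P : skewpoly s) * p = c *: (p : {poly K}).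
Proof.
apply/polyP=> k; rewrite coef_mul_skew coefZ big_ord_recl /= coefC subn0.
by rewrite big1 ?addr0 // => i _; rewrite coefC mul0r.
Qed.

Lemma skewpoly_mulX p : ('X : skewpoly s) * p = map_poly s p * 'X :> {poly K}.
Proof.
apply/polyP=> -[|k]; rewrite coef_mul_skew coefMX big_ord_recl coefX /= mul0r add0r.
  by rewrite big_ord0.
rewrite big_ord_recl coefX /= mul1r subSS subn0 coef_map big1 ?addr0 // => i _.
by rewrite coefX mul0r.
Qed.

Lemma skewpoly_mulXr p : p * ('X : skewpoly s) = (p : {poly K}) * 'X.
Proof.
have it0 i : iter i s 0 = 0 by elim: i => //= i ->; rewrite rmorph0.
have it1 i : iter i s 1 = 1 by elim: i => //= i ->; rewrite rmorph1.
apply/polyP=> k; rewrite coef_mul_skew_rev coefMX big_ord_recl coefX /= it0 mulr0 add0r.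
case: k => [|k]; first by rewrite big_ord0.
rewrite big_ord_recl coefX /= it1 mulr1 subn1 /= big1 ?addr0 // => i _.
by rewrite coefX it0 mulr0.
Qed.

(** Bounds rather than exact degrees, so that the formula serves both leading coefficients of
    products and the cancellation in the division. *)
Lemma coef_skew_top p q m n : (size p <= m.+1)%N -> (size q <= n.+1)%N ->
  (p * q : {poly K})`_(m + n) = (p : {poly K})`_m * iter m s (q : {poly K})`_n.
Proof.
move=> pm qn; rewrite coef_mul_skew.
have it0 i : iter i s 0 = 0 by elim: i => //= i ->; rewrite rmorph0.
have m_lt : (m < (m + n).+1)%N by rewrite ltnS leq_addr.
rewrite (bigD1 (Ordinal m_lt)) //= addKn big1 ?addr0 // => i.
rewrite -val_eqE /= neq_ltn => /orP[im|mi].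
  rewrite [q`__]nth_default ?it0 ?mulr0 // (leq_trans qn) //.
  by rewrite ltn_subRL; rewrite ltn_add2r.
by rewrite nth_default ?mul0r // (leq_trans pm).
Qed.

(** The top coefficient p_m s^m(q_n) is nonzero because [s], a morphism of fields, is injective. *)
Lemma skewpoly_prod_size p q : p != 0 -> q != 0 ->
  size (p * q : {poly K}) = (size p + size q).-1.
Proof.
rewrite -!(size_poly_gt0 (_ : {poly K})) => p0 q0.
apply/eqP; rewrite eqn_leq size_poly /=.
have [[m pm] [n qn]] : (exists m, size p = m.+1) /\ exists n, size q = n.+1.
  by split; [exists (size p).-1 | exists (size q).-1]; rewrite prednK.
rewrite pm qn addSn addnS /= ltnNge.
apply/negP=> /(nth_default 0)/eqP; apply/negP.
rewrite coef_skew_top ?pm ?qn // mulf_neq0 //.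
  by rewrite -[m]/(m.+1.-1) -pm lead_coef_eq0 -size_poly_gt0.
have: (q : {poly K})`_n != 0.
  by rewrite -[n]/(n.+1.-1) -qn lead_coef_eq0 -size_poly_gt0.
by elim: (m) => //= i IHi /IHi; rewrite fmorph_eq0.
Qed.

Lemma lead_coef_skew p q : p != 0 -> q != 0 ->
  lead_coef (p * q : {poly K})
    = lead_coef p * iter (size p).-1 s (lead_coef q).
Proof.
move=> p0 q0; rewrite /lead_coef skewpoly_prod_size // -coef_skew_top ?leqSpred //.
congr (_`__); move: p0 q0; rewrite -!(size_poly_gt0 (_ : {poly K})).
by case: (size p) (size q) => [|m] [|n]; rewrite //= addnS.
Qed.

Lemma skewpoly_mul_neq0 p q : p != 0 -> q != 0 -> p * q != 0.
Proof.
move=> p0 q0; rewrite -(size_poly_gt0 (_ : {poly K})) skewpoly_prod_size //.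
move: p0 q0; rewrite -!(size_poly_gt0 (_ : {poly K})).
by case: (size p) (size q) => [|m] [|n]; rewrite //= addnS.
Qed.

Lemma skewpoly_mul1 p q : p * q = 1 ->
  [/\ p != 0, q != 0, size p = 1%N & size q = 1%N].
Proof.
move=> pq1; have p0 : p != 0.
  by apply/eqP=> p0; have /eqP := oner_neq0 (skewpoly s); rewrite -pq1 p0 mul0r.
have q0 : q != 0.
  by apply/eqP=> q0; have /eqP := oner_neq0 (skewpoly s); rewrite -pq1 q0 mulr0.
have := skewpoly_prod_size p0 q0; rewrite pq1 size_poly1.
move: (p0) (q0); rewrite -!(size_poly_gt0 (_ : {poly K})).
by case: (size p) (size q) => [|[|m]] [|[|n]]; rewrite // !addSn ?addnS.
Qed.

Lemma skewpoly_edivr (p q : skewpoly s) : q != 0 ->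
  exists u v : skewpoly s, p = u * q + v /\ (size v < size q)%N.
Proof.
move=> q0; elim/ltn_ind: {p}(size p) {-2}p (erefl (size p)) => n IHn p pn.
have [|le_qp] := ltnP (size p) (size q); first by exists 0, p; rewrite mul0r add0r.
have q_gt0 : (0 < size q)%N by rewrite size_poly_gt0.
have p_gt0 : (0 < size p)%N := leq_trans q_gt0 le_qp.
pose k := (size p - size q)%N.
have sq0 : iter k s (lead_coef q) != 0.
  have: lead_coef q != 0 by rewrite lead_coef_eq0.
  by elim: (k) => //= i IHi /IHi; rewrite fmorph_eq0.
(* Moving [X^k] past the leading coefficient of [q] applies [s^k] to it, hence the denominator. *)
pose c := lead_coef p / iter k s (lead_coef q).
pose t : skewpoly s := (c *: 'X^k : {poly K}).
have tk : (size t <= k.+1)%N by rewrite (leq_trans (size_scale_leq _ _)) ?size_polyXn.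
have kE : (k + (size q).-1)%N = (size p).-1.
  by rewrite /k -subn1 addnBA // subnK // subn1.
have tq : (t * q : {poly K})`_(size p).-1 = lead_coef p.
  rewrite -kE coef_skew_top ?leqSpred // coefZ coefXn eqxx mulr1.
  by rewrite divfK.
have lt_n : (size ((p : {poly K}) - (t * q : skewpoly s) : {poly K})%R < n)%N.
  rewrite -pn -(prednK p_gt0) ltnS; apply/leq_sizeP=> j.
  rewrite leq_eqVlt => /predU1P[<-|lt_j].
    by rewrite coefB tq subrr.
  have le_j : (size p <= j)%N by rewrite -(prednK p_gt0).
  rewrite coefB nth_default // nth_default ?subr0 // (leq_trans _ le_j) //.
  rewrite (leq_trans (size_poly _ _)) //.
  rewrite -(prednK p_gt0) -kE -(prednK q_gt0) addnS /= -addSn leq_add2r //.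
have [u [v [puv v_lt]]] := IHn _ lt_n _ erefl.
exists (t + u), v; split=> //.
by rewrite mulrDl -addrA -puv addrC subrK.
Qed.

End SkewPolyTheory.

(** * D_P as a quotient of the skew polynomial ring, and its simplicity *)

Section CompanionModule.
Variables (F : finFieldType) (L : fieldExtType F).
Local Notation sig := (@sigma F L).
Implicit Types P Q : skewpoly sig.

(** Computes a coordinate of [phi v], with [a i] for sigma(v_i) and [x] for P_j: a shift plus the
    overflow of the last coordinate. *)
Lemma sum_companion_row d (a : nat -> L) (x : L) j : (j < d)%N ->
  \sum_(i < d) a i * (if (i.+1 < d)%N then (j == i.+1)%:R else - x)
    = (if j is k.+1 then a k else 0) - a d.-1 * x.
Proof.
case: d => // n lt_jn; rewrite big_ord_recr /= ltnn mulrN; congr (_ - _).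
rewrite (eq_bigr (fun i : 'I_n => if j == i.+1 then a i else 0)); last first.
  by move=> i _; rewrite /= ltnS ltn_ord; case: eqP; rewrite ?mulr1 ?mulr0.
case: j lt_jn => [|k]; first by move=> _; rewrite big1.
rewrite ltnS => lt_kn; rewrite (bigD1 (Ordinal lt_kn)) //= eqxx big1 ?addr0 // => i.
by rewrite -val_eqE /= eqSS eq_sym => /negPf->.
Qed.

(** Through [rVpoly], D_P is the quotient by the left ideal generated by [P], and [phi] is left
    multiplication by X; the quotient in the division by [P] is a constant. *)
Lemma skewX_rVpoly P (v : 'rV[L]_(deg P)) : (P : {poly L}) \is monic ->
  ('X : skewpoly sig) * (rVpoly v : skewpoly sig)
    = (rVpoly (phi v) : skewpoly sig)
      + ((sigma (rVpoly v)`_(deg P).-1)%:P : skewpoly sig) * P.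
Proof.
move=> Pm.
have sP : size P = (deg P).+1.
  by rewrite prednK // size_poly_gt0 monic_neq0.
have v_big k : (deg P <= k)%N -> (rVpoly v)`_k = 0.
  by move=> le_k; rewrite nth_default // (leq_trans (size_poly _ _)).
rewrite skewpoly_mulX skewpoly_mulC; apply/polyP=> j.
rewrite coefD coefZ coefMX coef_map.
have [lt_j|] := ltnP j (deg P).
  have -> : (rVpoly (phi v))`_j = phi v 0 (Ordinal lt_j) by rewrite -coef_rVpoly_ord.
  rewrite /phi summxE.
  rewrite (eq_bigr (fun i : 'I_(deg P) => sigma (rVpoly v)`_i *
     (if (i.+1 < deg P)%N then (j == i.+1)%:R else - (P : {poly L})`_j))).
    rewrite (sum_companion_row (fun i => sigma (rVpoly v)`_i)) // subrK.
    by case: (j).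
  by move=> i _; rewrite mxE coef_rVpoly_ord /phi_basis; case: ifP; rewrite mxE.
rewrite leq_eqVlt => /predU1P[<-|lt_j].
  have -> : (P : {poly L})`_(deg P) = 1 by move/monicP: Pm.
  rewrite [(rVpoly _)`_(deg P)]nth_default ?size_poly // add0r mulr1.
  (* If [deg P = 0], [(deg P).-1] still reads index 0, where the polynomial of an empty row is 0. *)
  by case: eqP => // d0; rewrite v_big ?d0 ?rmorph0.
rewrite (v_big j.-1); last by case: (j) lt_j.
rewrite nth_default ?(leq_trans (size_poly _ _)) ?(ltnW lt_j) // add0r.
rewrite [P`_j]nth_default ?sP // mulr0; case: eqP => // _; exact: rmorph0.
Qed.

Lemma size_rVpoly (R : nzSemiRingType) d (v : 'rV[R]_d) : (size (rVpoly v) <= d)%N.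
Proof. exact: size_poly. Qed.

(** The preimage in the skew polynomial ring of the subspace [W] of D_P; it is a left ideal as soon
    as [W] is stable under [phi]. *)
Definition in_ideal P k (W : 'M[L]_(k, deg P)) (A : skewpoly sig) :=
  exists (w : 'rV[L]_(deg P)) (B : skewpoly sig),
    (w <= W)%MS /\ A = (rVpoly w : skewpoly sig) + B * P.

Section Stable.
Variables (P : skewpoly sig) (k : nat) (W : 'M[L]_(k, deg P)).
Hypothesis P_monic : (P : {poly L}) \is monic.
Hypothesis W_stable : forall v, (v <= W)%MS -> (@phi _ _ P v <= W)%MS.

Lemma in_idealD A B : in_ideal W A -> in_ideal W B -> in_ideal W (A + B).
Proof.
move=> [w [C [wW ->]]] [w' [C' [w'W ->]]]; exists (w + w'), (C + C').
split; first exact: addmx_sub.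
by rewrite mulrDl addrACA; congr (_ + _); apply/esym/raddfD.
Qed.

Lemma in_ideal_mulC c A : in_ideal W A -> in_ideal W ((c%:P : skewpoly sig) * A).
Proof.
move=> [w [C [wW ->]]]; exists (c *: w), ((c%:P : skewpoly sig) * C).
split; first exact: scalemx_sub.
by rewrite mulrDr mulrA skewpoly_mulC; congr (_ + _); apply/esym/linearZ.
Qed.

Lemma in_ideal_mulX A : in_ideal W A -> in_ideal W (('X : skewpoly sig) * A).
Proof.
move=> [w [C [wW ->]]]; have Xw := skewX_rVpoly w P_monic.
exists (phi w), (((sigma (rVpoly w)`_(deg P).-1)%:P : skewpoly sig)
  + ('X : skewpoly sig) * C).
split; first exact: W_stable.
by rewrite mulrDr Xw mulrDl !mulrA addrA.
Qed.

Lemma in_idealM C A : in_ideal W A -> in_ideal W (C * A).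
Proof.
elim/poly_ind: C A => [|C c IHC] A AW.
  rewrite mul0r; exists 0, 0; rewrite sub0mx mul0r addr0; split=> //.
  exact/esym/raddf0.
have -> : (C * 'X + c%:P)%R = (C : skewpoly sig) * ('X : skewpoly sig)
    + (c%:P : skewpoly sig) :> skewpoly sig by rewrite skewpoly_mulXr.
rewrite mulrDl -mulrA.
by apply: in_idealD; [apply/IHC/in_ideal_mulX | apply: in_ideal_mulC].
Qed.

Lemma in_ideal_mod : in_ideal W P.
Proof. 
exists 0, 1; rewrite sub0mx mul1r; split=> //.
by rewrite -[LHS]add0r; congr (_ + _); apply/esym/raddf0.
 Qed.

(** A nonzero multiple of [P] has size above [deg P], so [A] is its own remainder. *)
Lemma in_ideal_small A : in_ideal W A -> (size A <= deg P)%N ->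
  exists2 w, (w <= W)%MS & A = rVpoly w.
Proof.
move=> [w [B [wW ->]]] szA; exists w => //.
have [->|B0] := eqVneq B 0; first by rewrite mul0r addr0.
have P0 : P != 0 by apply: monic_neq0 P_monic.
have szBP : (size (B * P : skewpoly sig)%R <= deg P)%N.
  have -> : B * P = (rVpoly w : skewpoly sig) + B * P - (rVpoly w : skewpoly sig).
    by rewrite addrC addKr.
  rewrite (leq_trans (size_polyD _ _)) // geq_max szA size_polyN.
  exact: size_rVpoly.
suff: (deg P < size (B * P : skewpoly sig)%R)%N by rewrite ltnNge szBP.
rewrite skewpoly_prod_size // /deg; move: B0 P0.
rewrite -!(size_poly_gt0 (_ : {poly L})).
by case: (size B) (size P) => [|b] [|m] //= _ _; rewrite addnS ltnS leq_addl.
Qed.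

(** Simplicity of D_P, by descent on the size of [v]. The remainder of [P] by [v] lies in the ideal
    of [W], so if nonzero it is a smaller vector of [W]. If it is zero, [v] is a right factor of [P]
    of size at most [deg P], hence a unit, and the ideal contains 1. *)
Lemma irreducible_stable_full (v : 'rV[L]_(deg P)) :
  irreducible_elt P -> v != 0 -> (v <= W)%MS -> row_full W.
Proof.
move=> [_ P_irr].
have [n] := ubnP (size (rVpoly v)); elim: n v => // n IHn v; rewrite ltnS => vn v0 vW.
have rv0 : (rVpoly v : skewpoly sig) != 0.
  by apply: contraNneq v0 => rv0; rewrite -[v]rVpolyK rv0 linear0.
have P0 : P != 0 by apply: monic_neq0 P_monic.
have vId : in_ideal W (rVpoly v : skewpoly sig).
  by exists v, 0; rewrite mul0r addr0.
have [Q [R [PQR ltR]]] := skewpoly_edivr P rv0.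
have RId : in_ideal W R.
  have -> : R = P + (- Q) * (rVpoly v : skewpoly sig).
    by rewrite mulNr; apply: (canRL (addrK _)); rewrite addrC; apply: esym.
  by apply: in_idealD; [apply: in_ideal_mod | apply: in_idealM].
have [R0|R0] := eqVneq R 0; last first.
  have [|w wW Rw] := in_ideal_small RId.
    by rewrite ltnW // (leq_trans ltR) // size_rVpoly.
  apply: IHn wW; first by rewrite -Rw (leq_trans ltR).
  by apply: contraNneq R0 => w0; rewrite Rw w0 linear0.
rewrite R0 addr0 in PQR.
have [[Q' [QQ' _]]|[C [CR _]]] := P_irr _ _ PQR.
  have : (size P <= deg P)%N.
    have -> : size P = size (rVpoly v); last exact: size_rVpoly.
    have [_ Q0 _ sQ] := skewpoly_mul1 QQ'.
    by rewrite {1}PQR skewpoly_prod_size // sQ.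
  by rewrite /deg -ltnS prednK ?ltnn // size_poly_gt0.
have id1 : in_ideal W 1 by rewrite -CR; apply: in_idealM.
rewrite -sub1mx; apply/row_subP=> i.
have [|w wW] := @in_ideal_small (rVpoly (row i 1%:M)) _ (size_rVpoly _).
  by rewrite -[X in in_ideal _ X](mulr1 (_ : skewpoly sig)); apply: in_idealM.
by move/(can_inj rVpolyK) => ->.
Qed.

End Stable.

End CompanionModule.

(** * Simple modules *)

Section Frobenius.
Variables (F : finFieldType) (L : fieldExtType F).
Local Notation r := (\dim {:L}).

(** The sum is the value at b of a polynomial of degree below q^r; vanishing on all q^r elements of
    L it is zero, and its coefficient of X is [c 0]. *)
Lemma sigma_artin (c : nat -> L) :
  (forall b, \sum_(i < r) c i * iter i (@sigma F L) b = 0) -> c 0%N = 0.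
Proof.
move=> c0; have q_gt1 : (1 < #|F|)%N := finRing_gt1 F.
have r_gt0 : (0 < r)%N by rewrite adim_gt0.
pose p : {poly L} := \sum_(i < r) c i *: 'X^(#|F| ^ i).
have cardL : #|FinFieldExtType L| = (#|F| ^ r)%N.
  by rewrite -(@card_vspace F (finvect_type L) _ fullv) card_vspacef.
have [p0|p_neq0] := eqVneq p 0.
  have := congr1 (fun q : {poly L} => q`_1) p0.
  rewrite /p coef0 coef_sum -(prednK r_gt0) big_ord_recl coefZ coefXn mulr1.
  rewrite big1 ?addr0 // => i _; rewrite coefZ coefXn.
  by rewrite ltn_eqF ?mulr0 // -[1%N](expn0 #|F|) ltn_exp2l.
pose e : seq L := enum (FinFieldExtType L).
have sz_e : size e = (#|F| ^ r)%N by rewrite -cardL cardE.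
have rootp : all (root p) e.
  apply/allP=> b _; rewrite rootE /p horner_sum; apply/eqP; rewrite -[RHS](c0 b).
  by apply: eq_bigr => i _; rewrite hornerZ hornerXn iter_sigmaE.
have := max_poly_roots p_neq0 rootp (enum_uniq _); rewrite sz_e ltnNge.
case/negP; apply: leq_trans (size_sum _ _ _) _; apply/bigmax_leqP=> i _.
by rewrite (leq_trans (size_scale_leq _ _)) // size_polyXn ltn_exp2l.
Qed.

Lemma descend_poly (h : {poly L}) :
  map_poly (@sigma F L) h = h -> exists h' : {poly F}, h = map_poly (in_alg L) h'.
Proof.
move=> sh; exists (map_poly (@descend F L) h).
have desc0 : @descend F L 0 = 0.
  by apply: (fmorph_inj (in_alg L)); rewrite rmorph0 /= descendE // rmorph0.
apply/polyP=> i; rewrite coef_map /= coef_map_id0 // descendE //.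
by rewrite -[in RHS]sh coef_map.
Qed.

Lemma sigma_in_alg (c : F) : sigma (c%:A : L) = c%:A.
Proof. by rewrite /sigma exprZn expr1n expf_card. Qed.

(** [g] may split over L, but a monic divisor fixed by [sigma] descends to F, which gives the
    restricted irreducibility that [norm_onto_modulo] asks for. *)
Lemma norm_inverse_modulo (g : {poly F}) :
    irreducible_poly g -> g \is monic -> coprimep 'X g ->
  exists u : {poly L}, map_poly (in_alg L) g
    %| (\prod_(i < r) iter i (map_poly (@sigma F L)) u) * 'X - 1.
Proof.
move=> [g_gt1 g_irr] gm cXg; pose gL := map_poly (in_alg L) g.
have sgL : map_poly (@sigma F L) gL = gL.
  by apply/polyP=> i; rewrite coef_map coef_map; apply: sigma_in_alg.
have gL_irr (h : {poly L}) : h \is monic -> map_poly (@sigma F L) h = h -> h %| gL ->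
    h = 1 \/ h = gL.
  move=> hm /descend_poly[h' h'E]; rewrite h'E map_monic in hm.
  rewrite h'E dvdp_map => hg; have [/eqP h1|h1] := boolP (size h' == 1%N).
    left; suff -> : h' = 1 by rewrite rmorph1.
    by apply/eqP; rewrite -eqp_monic ?monic1 // -size_poly_eq1 h1.
  by right; congr map_poly; apply/eqP; rewrite -eqp_monic // g_irr.
(* L with its finite field structure, which the counting argument requires. *)
pose K := FinFieldExtType L.
pose s : {rmorphism K -> K} := (@sigma F L : {rmorphism L -> L}).
have X_K : map_poly s ('X : {poly K}) = 'X by apply: map_polyX.
have cXgL : coprimep ('X : {poly K}) (gL : {poly K}).
  suff: coprimep ('X : {poly L}) gL by [].
  by rewrite -(map_polyX (in_alg L)) coprimep_map.
have gLm : (gL : {poly K}) \is monic.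
  by have: gL \is monic by rewrite map_monic.
have gL_gt1 : (1 < size (gL : {poly K}))%N.
  by have: (1 < size gL)%N by rewrite size_map_poly.
have [u Nu] := @norm_onto_modulo K s r (@iter_sigma_id F L)
  (@sigma_artin) gL gLm gL_gt1 sgL gL_irr 'X X_K cXgL.
by exists u.
Qed.

End Frobenius.

(** * Irreducibility of the characteristic polynomial of f^r on a simple module *)

Section SimpleModule.
Variables (F : finFieldType) (L : fieldExtType F).
Local Notation r := (\dim {:L}).
Local Notation sig := (@sigma F L).
Local Notation S := (map_poly sig).
Local Notation iota := (map_poly (in_alg L)).

Variables (n : nat) (f : 'rV[L]_n.+1 -> 'rV[L]_n.+1) (A M : 'M[L]_n.+1).
Hypothesis fE : forall v, f v = map_mx sig v *m A.
Hypothesis f_r : forall v, iter r f v = v *m M.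
Hypothesis f_simple : forall k (W : 'M[L]_(k, n.+1)) (v : 'rV[L]_n.+1),
  (forall w, (w <= W)%MS -> (f w <= W)%MS) -> v != 0 -> (v <= W)%MS -> row_full W.

Local Notation H := (horner_mx M).

Lemma semilinD v w : f (v + w) = f v + f w.
Proof. by rewrite !fE map_mxD mulmxDl. Qed.

Lemma semilinZ c v : f (c *: v) = sig c *: f v.
Proof. by rewrite !fE map_mxZ scalemxAl. Qed.

Lemma semilin0 : f 0 = 0.
Proof. by rewrite fE map_mx0 mul0mx. Qed.

(** [M] is the matrix of f^r and so commutes with [f]; only the coefficients of [p] get twisted. *)
Lemma semilin_horner v p : f (v *m H p) = f v *m H (S p).
Proof.
elim/poly_ind: p => [|p c IHp]; first by rewrite !rmorph0 !mulmx0 semilin0.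
rewrite !(rmorphD, rmorphM) /= map_polyX map_polyC /= !horner_mx_X !horner_mx_C.
rewrite !mulmxDr semilinD !mul_mx_scalar semilinZ; congr (_ + _).
rewrite -[H p * M]/(H p *m M) -[H (S p) * M]/(H (S p) *m M) !mulmxA -IHp.
by rewrite -!f_r -iterSr -iterS.
Qed.

(** For a nonconstant divisor q of a minimal g = t q, the kernel of q(M) is stable under [f], since
    q has coefficients in F. If it is zero, t(M) = 0 contradicts minimality; otherwise it is
    everything, so q(M) = 0 and q has the size of g. *)
Lemma exists_minimal_annihilator (psi : {poly F}) :
    psi != 0 -> H (iota psi) = 0 ->
  exists g : {poly F}, [/\ irreducible_poly g, g \is monic, H (iota g) = 0 &
    forall h : {poly F}, h != 0 -> H (iota h) = 0 -> (size g <= size h)%N].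
Proof.
move=> psi0 Hpsi.
(* Polynomials of bounded size over F form a finite type, so this is a boolean predicate and has a
   least [k]. *)
pose annih k := [exists h : {poly_k F}, ((h : {poly F}) != 0) && (H (iota h) == 0)].
have annihP (h : {poly F}) : h != 0 -> H (iota h) = 0 -> annih (size h).
  move=> h0 Hh; apply/existsP; exists (npolyp (size h) h).
  by rewrite npolypK // h0 Hh eqxx.
have ex_annih : exists k, annih k by exists (size psi); apply: annihP.
case: (ex_minnP ex_annih) => k /existsP[g0 /andP[g0_neq0 /eqP Hg0]] k_min.
pose c := (lead_coef (g0 : {poly F}))^-1.
have c0 : c != 0 by rewrite invr_eq0 lead_coef_eq0.
pose g := c *: (g0 : {poly F}).
have g_neq0 : g != 0 by rewrite scaler_eq0 negb_or c0.
have gm : g \is monic by rewrite monicE lead_coefZ mulVf // lead_coef_eq0.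
have Hg : H (iota g) = 0 by rewrite map_polyZ linearZ /= Hg0 scaler0.
have g_min (h : {poly F}) : h != 0 -> H (iota h) = 0 -> (size g <= size h)%N.
  move=> h0 Hh; rewrite size_scale // (leq_trans (size_npoly g0)) //.
  exact/k_min/annihP.
exists g; split=> //; split=> [|q q1 /dvdpP[t gE]].
  rewrite ltnNge; apply/negP=> g_le1.
  have g1 : g = 1.
    apply/eqP; rewrite -eqp_monic ?monic1 // -size_poly_eq1.
    by rewrite eqn_leq g_le1 size_poly_gt0.
  by move/eqP: Hg; rewrite g1 !rmorph1 oner_eq0.
have [t0 q0] : t != 0 /\ q != 0.
  by apply/andP; rewrite -negb_or -mulf_eq0 -gE.
have q_g : q %| g by rewrite gE dvdp_mull.
have sq : map_poly sig (iota q) = iota q.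
  by apply/polyP=> i; rewrite coef_map coef_map; apply: sigma_in_alg.
have ker_stable w : (w <= kermx (H (iota q)))%MS -> (f w <= kermx (H (iota q)))%MS.
  by move=> /sub_kermxP wq; apply/sub_kermxP; rewrite -{1}sq -semilin_horner wq semilin0.
have Htq : H (iota t) *m H (iota q) = 0.
  by rewrite -[LHS]/(_ * _) -!rmorphM -gE.
have [|] := eqVneq (kermx (H (iota q))) 0.
  move/eqP; rewrite kermx_eq0 => q_free.
  have : (size g <= size t)%N.
    by apply: g_min => //; apply/eqP; rewrite -(mulmx_free_eq0 _ q_free) Htq.
  rewrite gE size_mul // => le_t; case/eqP: q1.
  apply/eqP; rewrite eqn_leq size_poly_gt0 q0 andbT.
  by move: le_t; rewrite -subn1 leq_subLR addnC leq_add2r.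
case/rowV0Pn=> v vq v0; have := f_simple ker_stable v0 vq.
rewrite -sub1mx => /sub_kermxP; rewrite mul1mx => Hq0.
by rewrite -dvdp_size_eqp // eqn_leq dvdp_leq // g_min.
Qed.

Lemma exists_eigenvector (g : {poly F}) :
    irreducible_poly g -> g \is monic -> H (iota g) = 0 ->
  exists (v : 'rV[L]_n.+1) (u : {poly L}), v != 0 /\ f v = v *m H u.
Proof.
move=> g_irr gm Hg0.
have [Mf|Mf] := boolP (row_free M); last first.
  have : kermx M != 0 by rewrite kermx_eq0.
  case/rowV0Pn=> v /sub_kermxP vM v0.
  (* The last nonzero iterate of [v]; it exists because f^r v = v M = 0. *)
  have [i fi0 fiS] : exists2 i, iter i f v != 0 & f (iter i f v) = 0.
    have: iter r f v = 0 by rewrite f_r.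
    elim: (r) => [|k IHk] /=; first by move/eqP; rewrite (negPf v0).
    by have [/IHk|k0] := eqVneq (iter k f v) 0; last by exists k.
  by exists (iter i f v), 0; rewrite rmorph0 mulmx0.
(* If X divided [g], then [g] would be X and [M] would be 0, which is not invertible. *)
have cXg : coprimep 'X g.
  rewrite coprimep_sym coprimepX; apply/negP; rewrite -dvdp_XsubCl subr0 => Xg.
  have : g %= 'X.
    by rewrite eqp_sym; case: g_irr => _; apply; rewrite ?size_polyX.
  rewrite eqp_monic ?monicX // => /eqP gX; move: Mf Hg0.
  rewrite gX map_polyX horner_mx_X => Mf M0; move: Mf.
  by rewrite M0 /row_free mxrank0.
have [u Nu] := norm_inverse_modulo L g_irr gm cXg.
pose cU i := \prod_(j < i) iter j S u.
have cUS i : u * S (cU i) = cU i.+1.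
  by rewrite /cU big_ord_recl /= rmorph_prod.
(* The norm [cU r] of [u], evaluated at [M], is the inverse of [M]; this makes psi^r the
   identity. *)
pose psi v := f v *m H u.
have psiE i v : iter i psi v = iter i f v *m H (cU i).
  elim: i => [|i IHi]; first by rewrite /cU big_ord0 rmorph1 mulmx1.
  rewrite iterS IHi /psi semilin_horner -mulmxA -cUS mulrC.
  by congr (_ *m _); apply/esym/rmorphM.
have HN : H (cU r * 'X) = 1.
  have /dvdpP[k kE] := Nu.
  have -> : cU r * 'X = k * iota g + 1 by rewrite -kE subrK.
  by rewrite rmorphD rmorphM /= Hg0 mulr0 rmorph1 add0r.
have MN : M *m H (cU r) = 1%:M.
  by rewrite -[RHS]HN mulrC [RHS]rmorphM /= horner_mx_X.
have psi_r v : iter r psi v = v by rewrite psiE f_r -mulmxA MN mulmx1.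
have psiD v w : psi (v + w) = psi v + psi w by rewrite /psi semilinD mulmxDl.
have psiZ c v : psi (c *: v) = sig c *: psi v.
  by rewrite /psi semilinZ scalemxAl.
have iterZ i c v : iter i psi (c *: v) = iter i sig c *: iter i psi v.
  by elim: i => //= i ->.
have psi0 : psi 0 = 0 by rewrite /psi semilin0 mul0mx.
pose e : 'rV[L]_n.+1 := delta_mx 0 0.
(* A sum over a full period of [psi], hence fixed by [psi]. *)
pose w b := \sum_(i < r) iter i psi (b *: e).
have psi_w b : psi (w b) = w b.
  apply/eqP; rewrite -subr_eq0 /w (big_morph psi psiD psi0) -sumrB.
  rewrite -(big_mkord xpredT (fun i => iter i.+1 psi (b *: e) - iter i psi (b *: e))).
  by rewrite telescope_sumr // psi_r subrr.
(* Read in the first coordinate, [w b = 0] for all [b] would be a relation among the powers of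
   [sigma] whose coefficient at the identity is that coordinate of [e], namely 1. *)
have [b wb] : exists b : FinFieldExtType L, w b != 0.
  apply/existsP; apply/existsPn => /= w0.
  have /eqP : (iter 0 psi e) 0 0 = 0.
    apply: (sigma_artin (c := fun i => (iter i psi e) 0 0)) => b.
    have := w0 b; rewrite negbK => /eqP/matrixP/(_ 0 0); rewrite mxE /w summxE => wb0.
    by rewrite -[RHS]wb0; apply: eq_bigr => i _; rewrite iterZ mxE mulrC.
  by rewrite /= mxE !eqxx oner_eq0.
(* The other conjugates of [u] times X: by [HN] this inverts [H u], so a vector fixed by [psi]
   satisfies [f v = v *m H u']. *)
pose u' := (\prod_(i < r.-1) iter i.+1 S u) * 'X.
have Huu' : H u *m H u' = 1%:M.
  rewrite -[LHS]/(_ * _) -rmorphM -[RHS]HN mulrA; congr (H (_ * _)).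
  by rewrite /cU -(prednK (adim_gt0 _)) big_ord_recl.
exists (w b), u'; split=> //.
by rewrite -{2}[w b]psi_w /psi -mulmxA Huu' mulmx1.
Qed.

Lemma simple_dim_le (g : {poly F}) :
    irreducible_poly g -> g \is monic -> H (iota g) = 0 -> (n.+1 < size g)%N.
Proof.
move=> g_irr gm Hg0; have [v [u [v0 fv]]] := exists_eigenvector g_irr gm Hg0.
have g_gt1 := g_irr.1; pose m := (size g).-1.
have gE : size g = m.+1 by rewrite prednK // ltnW.
(* The rows of [W] are v M^i for i < m; they span L[M] v since [g] annihilates [M]. *)
pose W := powers_mx M m *m lin_mul_row v.
have WE (y : 'rV[L]_m) : y *m W = v *m H (rVpoly y).
  by rewrite horner_rVpoly mulmxA -[y *m powers_mx M m]vec_mxK mul_vec_lin_row vec_mxK.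
have mem_W p : (v *m H p <= W)%MS.
  have -> : v *m H p = poly_rV (p %% iota g) *m W.
    rewrite WE poly_rV_K; last first.
      by rewrite -ltnS -gE -(size_map_poly (in_alg L)) ltn_modp map_poly_eq0 monic_neq0.
    rewrite {1}(divp_eq p (iota g)) rmorphD rmorphM /= Hg0 mulr0 add0r //.
  exact: submxMl.
have W_stable w : (w <= W)%MS -> (f w <= W)%MS.
  case/submxP=> y ->; rewrite WE semilin_horner fv -mulmxA.
  by rewrite -[H _ *m H _]/(_ * _) -rmorphM mem_W.
have vW : (v <= W)%MS by have := mem_W 1; rewrite rmorph1 mulmx1.
have /eqP := f_simple W_stable v0 vW => <-.
by rewrite gE ltnS rank_leq_row.
Qed.

(** The minimal g divides [psi], and [simple_dim_le] bounds deg psi = n + 1 by deg g, so the two are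
    associates. *)
Lemma simple_char_poly_irreducible (psi : {poly F}) :
  iota psi = char_poly M -> irreducible_poly psi.
Proof.
move=> psiE; have Hpsi : H (iota psi) = 0 by rewrite psiE Cayley_Hamilton.
have size_psi : size psi = n.+2.
  by rewrite -(size_map_poly (in_alg L)) psiE size_char_poly.
have psi0 : psi != 0 by rewrite -size_poly_gt0 size_psi.
have [g [g_irr gm Hg0 g_min]] := exists_minimal_annihilator psi0 Hpsi.
have g_psi : g %| psi.
  rewrite /dvdp; apply: contraT => mod_neq0.
  have := g_min _ mod_neq0; rewrite leqNgt ltn_modp monic_neq0 //=.
  suff -> : H (iota (psi %% g)) = 0 by move/(_ erefl).
  rewrite -Hpsi {2}(divp_eq psi g) !(rmorphD, rmorphM) /= Hg0.
  by rewrite mulr0 add0r.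
have gpsi : g %= psi.
  rewrite -dvdp_size_eqp // eqn_leq dvdp_leq //= size_psi.
  exact: simple_dim_le.
split=> [|q q1 q_psi]; first by rewrite size_psi.
by rewrite -(eqp_rtrans gpsi) g_irr.2 // (eqp_dvdr _ gpsi).
Qed.

End SimpleModule.

(** * Multiplicativity of Psi *)

Section SemilinearPower.
Variables (F : finFieldType) (L : fieldExtType F).
Local Notation r := (\dim {:L}).
Local Notation sig := (@sigma F L).

(** The twisted product sigma^(k-1)(A) ... sigma(A) A. *)
Definition semilinear_pow n (A : 'M[L]_n) k : 'M[L]_n :=
  iter k (fun B => map_mx sig B *m A) 1%:M.

Lemma iter_semilinear n (A : 'M[L]_n) k (v : 'rV[L]_n) :
  iter k (fun w => map_mx sig w *m A) v
    = map_mx (iter k sig) v *m semilinear_pow A k.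
Proof.
elim: k => [|k IHk]; first by rewrite mulmx1 map_mx_id.
by rewrite /= IHk map_mxM -mulmxA -map_mx_comp.
Qed.

Lemma semilinear_pow_ublock m n (A : 'M[L]_m) C (B : 'M[L]_n) k :
  exists D, semilinear_pow (block_mx A C 0 B) k
    = block_mx (semilinear_pow A k) D 0 (semilinear_pow B k).
Proof.
elim: k => [|k [D IHk]]; first by exists 0; rewrite -scalar_mx_block.
rewrite /= -!/(semilinear_pow _ _) IHk map_block_mx mulmx_block map_mx0.
by rewrite !mulmx0 !mul0mx !addr0 !add0r; eexists.
Qed.

(** At k = r the twist of [U] disappears, leaving an ordinary intertwining relation between the
    matrices of the r-th powers. *)
Lemma semilinear_pow_conj m n (A : 'M[L]_n) (B : 'M[L]_m) (U : 'M[L]_(m, n)) k :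
    map_mx sig U *m A = B *m U ->
  map_mx (iter k sig) U *m semilinear_pow A k = semilinear_pow B k *m U.
Proof.
move=> UAB; elim: k => [|k IHk]; first by rewrite mulmx1 mul1mx map_mx_id.
rewrite /= -!/(semilinear_pow _ _) mulmxA -[LHS]/(_ *m _ *m A).
have -> : map_mx (fun x => sig (iter k sig x)) U = map_mx sig (map_mx (iter k sig) U).
  by rewrite -map_mx_comp.
by rewrite -map_mxM IHk map_mxM -!mulmxA UAB.
Qed.

Lemma phi_r_pow (P : skewpoly sig) :
  lin1_mx (@phi_r _ _ P) = semilinear_pow (\matrix_i phi_basis i) r.
Proof.
apply/row_matrixP=> i; rewrite !rowE -phi_r_mxE /phi_r.
rewrite (eq_iter (@phi_mxE _ _ P)) iter_semilinear map_mx_id //.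
exact: iter_sigma_id.
Qed.

Lemma char_poly_ublock m n (A : 'M[L]_m) C (B : 'M[L]_n) :
  char_poly (block_mx A C 0 B) = char_poly A * char_poly B.
Proof.
rewrite /char_poly /char_poly_mx map_block_mx map_mx0 (scalar_mx_block _ _ 'X).
by rewrite opp_block_mx add_block_mx oppr0 addr0 det_ublock.
Qed.

(** [m = n] is a hypothesis because [deg Q + deg P] and [deg (P * Q)] are equal only by a proof. *)
Lemma char_poly_conj m n (A : 'M[L]_n) (B : 'M[L]_m) (U : 'M[L]_(m, n)) :
  m = n -> row_free U -> U *m A = B *m U -> char_poly A = char_poly B.
Proof.
move=> eq_mn; case: n / eq_mn A U => A U; rewrite row_free_unit => U_unit UAB.
by rewrite -(mulmxK U_unit B) -UAB -mulmxA char_poly_mulC -mulmxA mulVmx // mulmx1.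
Qed.

End SemilinearPower.

(** Uniqueness of the remainder for constant quotients, the case produced by [skewX_rVpoly]. *)
Lemma skew_mod_uniq (F : finFieldType) (L : fieldExtType F)
    (P : skewpoly (@sigma F L)) (a b : skewpoly (@sigma F L)) (c c' : L) :
    (P : {poly L}) \is monic -> (size a <= deg P)%N -> (size b <= deg P)%N ->
    a + (c%:P : skewpoly (@sigma F L)) * P
      = b + (c'%:P : skewpoly (@sigma F L)) * P ->
  a = b.
Proof.
move=> P_monic sa sb; have P0 : P != 0 by apply: monic_neq0 P_monic.
rewrite !skewpoly_mulC => ab.
have abE : a - b = (c' - c) *: (P : {poly L}).
  rewrite scalerBl; apply/eqP; rewrite subr_eq addrAC eq_sym subr_eq; apply/eqP.
  by rewrite addrC; apply: esym; rewrite addrC [RHS]addrC.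
have [e|ne] := eqVneq c' c.
  by apply/eqP; rewrite -subr_eq0 abE e subrr scale0r.
have : (size (a - b)%R <= deg P)%N.
  by rewrite (leq_trans (size_polyD _ _)) // geq_max size_polyN sa.
by rewrite abE size_scale ?subr_eq0 // /deg leqNgt prednK ?leqnn // size_poly_gt0.
Qed.

Lemma sum_last_row (R : pzRingType) d (a : nat -> R) (b : bool) :
  \sum_(i < d) a i * ((i == d.-1 :> nat) && b)%:R
    = if (0 < d)%N && b then a d.-1 else 0.
Proof.
case: d => [|d]; first by rewrite big_ord0.
rewrite big_ord_recr /= eqxx big1 ?add0r => [|i _].
  by case: b; rewrite ?mulr1 ?mulr0.
by rewrite ltn_eqF ?mulr0.
Qed.

Section PsiMul.
Variables (F : finFieldType) (L : fieldExtType F).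
Local Notation sig := (@sigma F L).
Variables (P Q : skewpoly sig).
Hypothesis P_monic : (P : {poly L}) \is monic.
Hypothesis Q_monic : (Q : {poly L}) \is monic.

Let P0 : P != 0. Proof. exact: monic_neq0 P_monic. Qed.
Let Q0 : Q != 0. Proof. exact: monic_neq0 Q_monic. Qed.

Lemma monic_skew_mul : (P * Q : {poly L}) \is monic.
Proof.
rewrite monicE lead_coef_skew // (monicP P_monic) (monicP Q_monic) mul1r.
by elim: (_.-1) => //= i /eqP->; apply/eqP/rmorph1.
Qed.

Lemma deg_skew_mul : deg (P * Q) = (deg Q + deg P)%N.
Proof.
rewrite /deg skewpoly_prod_size //; move: P0 Q0.
rewrite -!(size_poly_gt0 (_ : {poly L})) addnC.
by case: (size P) (size Q) => [|m] [|n] //= _ _; rewrite addnS.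
Qed.

(** Coordinates on D_PQ by division by [Q]: the first block is the remainder, in D_Q, the second the
    quotient, in D_P. *)
Definition prod_coord (v : 'rV[L]_(deg Q + deg P)) : 'rV[L]_(deg (P * Q)) :=
  poly_rV ((rVpoly (lsubmx v) : skewpoly sig) + (rVpoly (rsubmx v) : skewpoly sig) * Q).

Fact prod_coord_is_linear : linear prod_coord.
Proof.
move=> c v w; rewrite /prod_coord -linearP; congr poly_rV.
have lin_l : rVpoly (lsubmx (c *: v + w)) = c *: rVpoly (lsubmx v) + rVpoly (lsubmx w).
  by rewrite !linearP.
have lin_r : (rVpoly (rsubmx (c *: v + w)) : skewpoly sig) =
    (c%:P : skewpoly sig) * (rVpoly (rsubmx v) : skewpoly sig)
      + (rVpoly (rsubmx w) : skewpoly sig).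
  by rewrite skewpoly_mulC !linearP.
rewrite lin_l lin_r mulrDl -mulrA skewpoly_mulC scalerDr.
exact: addrACA.
Qed.

HB.instance Definition _ := GRing.isLinear.Build L _ _ _ prod_coord prod_coord_is_linear.

Lemma rVpoly_prod_coord v : rVpoly (prod_coord v) =
  (rVpoly (lsubmx v) : skewpoly sig) + (rVpoly (rsubmx v) : skewpoly sig) * Q.
Proof.
rewrite poly_rV_K // (leq_trans (size_polyD _ _)) // geq_max.
rewrite (leq_trans (size_rVpoly _)) ?deg_skew_mul ?leq_addr //=.
have [->|v0] := eqVneq (rVpoly (rsubmx v) : skewpoly sig) 0.
  by rewrite mul0r size_poly0.
rewrite skewpoly_prod_size // addnC -subn1 leq_subLR addnA.
have -> : size Q = (deg Q).+1 by rewrite prednK // size_poly_gt0.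
by rewrite add1n leq_add2l size_rVpoly.
Qed.

Lemma prod_coord_free : row_free (lin1_mx prod_coord).
Proof.
apply: inj_row_free => v; rewrite mul_rV_lin1 => /(congr1 rVpoly).
rewrite linear0 rVpoly_prod_coord => v0.
have r0 : (rVpoly (rsubmx v) : skewpoly sig) = 0.
  apply/eqP; apply: contraT => r_neq0.
  have : (size (- (rVpoly (lsubmx v) : {poly L})) <= deg Q)%N.
    by rewrite size_polyN size_rVpoly.
  have -> : - (rVpoly (lsubmx v) : {poly L}) = (rVpoly (rsubmx v) : skewpoly sig) * Q.
    by apply/esym/eqP; rewrite -addr_eq0 addrC; apply/eqP.
  rewrite skewpoly_prod_size //.
  have -> : size Q = (deg Q).+1 by rewrite prednK // size_poly_gt0.
  rewrite addnS /= leqNgt -{1}[deg Q]add0n ltn_add2r.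
  by rewrite size_poly_gt0 r_neq0.
move: v0; rewrite r0 mul0r addr0 => l0.
have inj d (w : 'rV[L]_d) : rVpoly w = 0 -> w = 0.
  by move=> w0; rewrite -[w]rVpolyK w0 linear0.
by rewrite -[v]hsubmxK (inj _ _ l0) (inj _ _ r0) row_mx0.
Qed.

(** In the coordinates [prod_coord], [phi] has diagonal blocks [AQ] and [AP]; [0 < deg P] gives the
    carry from the first block a constant coefficient to land in. *)
Lemma Psi_mul : (0 < deg P)%N -> Psi (P * Q) = Psi P * Psi Q.
Proof.
move=> dP_gt0; apply: (map_poly_inj (in_alg L)); rewrite rmorphM /= !map_Psi.
pose AP : 'M[L]_(deg P) := \matrix_i phi_basis i.
pose AQ : 'M[L]_(deg Q) := \matrix_i phi_basis i.
pose A : 'M[L]_(deg (P * Q)) := \matrix_i phi_basis i.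
have phiA w : map_mx sig w *m A = phi w by rewrite phi_mxE.
have phiAP w : map_mx sig w *m AP = phi w by rewrite phi_mxE.
have phiAQ w : map_mx sig w *m AQ = phi w by rewrite phi_mxE.
(* Division by Q leaves the quotient sigma(v_(deg Q - 1)), which is carried
   into the constant coefficient of the second block. *)
pose C : 'M[L]_(deg Q, deg P) :=
  \matrix_(i, j) ((i == (deg Q).-1 :> nat) && (j == 0 :> nat))%:R.
pose U := lin1_mx prod_coord.
have carryE (v : 'rV[L]_(deg Q)) :
    rVpoly (map_mx sig v *m C) = (sigma (rVpoly v)`_(deg Q).-1)%:P.
  have -> : (rVpoly v)`_(deg Q).-1 = if (0 < deg Q)%N then (rVpoly v)`_(deg Q).-1 else 0.
    case: posnP => // dQ0; rewrite nth_default //.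
    by rewrite (leq_trans (size_rVpoly _)) // dQ0.
  apply/polyP=> j; have [lt_j|le_j] := ltnP j (deg P); last first.
    rewrite nth_default ?(leq_trans (size_rVpoly _)) // coefC gtn_eqF //.
    exact: leq_trans le_j.
  have -> : (rVpoly (map_mx sig v *m C))`_j = (map_mx sig v *m C) 0 (Ordinal lt_j).
    by rewrite -coef_rVpoly_ord.
  rewrite mxE (eq_bigr (fun i : 'I_(deg Q) =>
    sigma (rVpoly v)`_i * ((i == (deg Q).-1 :> nat) && (j == 0%N))%:R)).
    rewrite (sum_last_row _ (fun i => sigma (rVpoly v)`_i)) coefC.
    by case: (j == 0%N); case: (0 < deg Q)%N => //=; apply/esym/rmorph0.
  by move=> i _; rewrite !mxE coef_rVpoly_ord.
have step (v : 'rV[L]_(deg Q + deg P)) :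
    map_mx sig v *m (map_mx sig U *m A)
      = map_mx sig v *m (block_mx AQ C 0 AP *m U).
  rewrite mulmxA -map_mxM phiA [RHS]mulmxA !mul_rV_lin1 /=.
  rewrite -[LHS]rVpolyK -[RHS]rVpolyK; congr poly_rV.
  (* Both sides are remainders of X times [prod_coord v] modulo [P * Q], so uniqueness identifies
     them. *)
  have PQm := monic_skew_mul.
  apply: (skew_mod_uniq (c' := sigma (rVpoly (rsubmx v))`_(deg P).-1) PQm
    (size_rVpoly _) (size_rVpoly _)).
    apply: etrans (esym (skewX_rVpoly (prod_coord v) PQm)) _.
    rewrite !rVpoly_prod_coord mulrDr (skewX_rVpoly _ Q_monic).
    rewrite mulrA (skewX_rVpoly _ P_monic).
    rewrite -[v in RHS]hsubmxK map_row_mx mul_row_block mulmx0 addr0.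
    rewrite !row_mxKl !row_mxKr phiAQ phiAP.
    rewrite linearD /= carryE.
    have skewE (a b c d : skewpoly sig) :
        a + c * Q + (b + d * P) * Q = a + (c + b) * Q + d * (P * Q).
      by rewrite !mulrDl -mulrA !addrA.
    exact: skewE.
have UAB : map_mx sig U *m A = block_mx AQ C 0 AP *m U.
  apply/row_matrixP=> i; rewrite !rowE.
  (* Basis vectors are fixed by [sigma], so [step] yields every row. *)
  have <- : map_mx sig (delta_mx 0 i : 'rV[L]_(deg Q + deg P)) = delta_mx 0 i.
    by apply: map_delta_mx.
  exact: step.
have UMM := semilinear_pow_conj (\dim {:L}) UAB.
rewrite map_mx_id in UMM; last exact: iter_sigma_id.
have [D BD] := semilinear_pow_ublock AQ C AP (\dim {:L}).
rewrite /PsiL !phi_r_pow -/A -/AP -/AQ mulrC -(char_poly_ublock _ D) -BD.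
by apply: char_poly_conj UMM; rewrite ?deg_skew_mul ?prod_coord_free.
Qed.

End PsiMul.

(** * Factorizations *)

Section Irreducibility.
Variables (F : finFieldType) (L : fieldExtType F).
Local Notation sig := (@sigma F L).
Implicit Types P Q : skewpoly sig.

Lemma size_Psi P : size (Psi P) = (deg P).+1.
Proof. by rewrite -(size_map_poly (in_alg L)) map_Psi size_char_poly. Qed.

Lemma is_unit_skewC (c : L) : c != 0 -> is_unit (c%:P : skewpoly sig).
Proof.
move=> c0; exists (c^-1%:P : skewpoly sig).
by rewrite !skewpoly_mulC -!mul_polyC -!polyCM mulVf ?mulfV.
Qed.

Lemma irreducible_deg_gt0 P : P != 0 -> irreducible_elt P -> (0 < deg P)%N.
Proof.
move=> P0 [P_nunit _]; rewrite lt0n; apply/eqP=> dP; apply: P_nunit.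
have PE : (P : {poly L}) = ((P : {poly L})`_0)%:P.
  by apply: size1_polyC; rewrite -[size P]prednK ?size_poly_gt0 // -/(deg P) dP.
rewrite PE; apply: is_unit_skewC; apply: contraNneq P0 => p0.
by rewrite PE p0.
Qed.

Lemma Psi_irreducible P : (P : {poly L}) \is monic -> irreducible_elt P ->
  irreducible_poly (Psi P).
Proof.
move=> Pm P_irr; have dP := irreducible_deg_gt0 (monic_neq0 Pm) P_irr.
have full k (W : 'M[L]_(k, deg P)) (v : 'rV[L]_(deg P)) stable v0 vW :=
  @irreducible_stable_full F L P k W Pm stable v P_irr v0 vW.
(* [deg P] is generalized to a positive [d] so that it can be replaced by a successor, as
   [horner_mx] demands. *)
have gen d (f : 'rV[L]_d -> 'rV[L]_d) (A M : 'M[L]_d) (psi : {poly F}) :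
    (0 < d)%N -> (forall v, f v = map_mx sig v *m A) ->
    (forall v, iter (\dim {:L}) f v = v *m M) ->
    (forall k (W : 'M[L]_(k, d)) (v : 'rV[L]_d),
      (forall w, (w <= W)%MS -> (f w <= W)%MS) -> v != 0 -> (v <= W)%MS -> row_full W) ->
    map_poly (in_alg L) psi = char_poly M -> irreducible_poly psi.
  case: d f A M => // n f A M _ fE frE f_simple.
  exact: (simple_char_poly_irreducible fE frE f_simple).
exact: gen dP (@phi_mxE F L P) (@phi_r_mxE F L P) full (map_Psi P).
Qed.

End Irreducibility.

(** * Unit multiples and monic factorizations *)

Section IrreducibleAssociates.
Variable R : nzRingType.

Lemma is_unitM (x y : R) : is_unit x -> is_unit y -> is_unit (x * y).
Proof.
move=> [x' [x'x xx']] [y' [y'y yy']]; exists (y' * x').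
by rewrite mulrA -(mulrA y') x'x mulr1 y'y mulrA -(mulrA x) yy' mulr1.
Qed.

(** A factorization y z of u x w turns into x = (u^-1 y)(z w^-1). *)
Lemma irreducible_eltMM (u x w : R) : is_unit u -> is_unit w ->
  irreducible_elt x -> irreducible_elt (u * x * w).
Proof.
move=> uU wU [x_nunit x_irr].
have [u' [u'u uu']] := uU; have [w' [w'w ww']] := wU.
have u'U : is_unit u' by exists u.
have w'U : is_unit w' by exists w.
have uK y : u' * (u * y) = y by rewrite mulrA u'u mul1r.
have uK' y : u * (u' * y) = y by rewrite mulrA uu' mul1r.
have wK y : y * w * w' = y by rewrite -mulrA ww' mulr1.
have wK' y : y * w' * w = y by rewrite -mulrA w'w mulr1.
split=> [/(is_unitM u'U)/is_unitM/(_ w'U)|y z xyz].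
  by rewrite -!mulrA uK mulrA wK.
have [|yU|zU] := x_irr (u' * y) (z * w').
- by rewrite mulrA -(mulrA u') -xyz -!mulrA uK ww' mulr1.
- by left; rewrite -(uK' y); apply: is_unitM.
- by right; rewrite -(wK' z); apply: is_unitM.
Qed.

End IrreducibleAssociates.

(** The scalar [c] carries the induction: the leading coefficient of the tail product is moved into
    the head factor from the right, so the tail is again a scalar times a monic polynomial. Unit
    factors change neither irreducibility nor degree. *)
Lemma monic_skew_factorization (F : finFieldType) (L : fieldExtType F)
    (ps : seq (skewpoly (@sigma F L))) (P : skewpoly (@sigma F L)) (c : L) :
    (forall f, f \in ps -> irreducible_elt f) ->
    (P : {poly L}) \is monic -> c != 0 ->
    \prod_(f <- ps) f = (c%:P : skewpoly (@sigma F L)) * P ->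
  exists qs : seq (skewpoly (@sigma F L)),
    [/\ forall f, f \in qs -> (f : {poly L}) \is monic /\ irreducible_elt f,
        \prod_(f <- qs) f = P & [seq deg f | f <- qs] = [seq deg f | f <- ps]].
Proof.
elim: ps P c => [|f t IHt] P c irr Pm c0.
  rewrite big_nil => /esym/skewpoly_mul1[_ _ _ sP]; exists [::]; split=> //.
  rewrite big_nil; have /eqP := sP; rewrite size_poly_eq1 eqp_monic ?monic1 //.
  by move/eqP.
have P0 : P != 0 by apply: monic_neq0 Pm.
rewrite big_cons; set T := \prod_(g <- t) g => fT.
have cP0 : (c%:P : skewpoly (@sigma F L)) * P != 0.
  by apply: skewpoly_mul_neq0; rewrite // polyC_eq0.
have f0 : f != 0 by apply: contraNneq cP0 => f0; rewrite -fT f0 mul0r.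
have T0 : T != 0 by apply: contraNneq cP0 => T0; rewrite -fT T0 mulr0.
pose c' := lead_coef T.
have c'0 : c' != 0 by rewrite lead_coef_eq0.
pose Q : skewpoly (@sigma F L) := (c'^-1%:P : skewpoly (@sigma F L)) * T.
have Qm : (Q : {poly L}) \is monic.
  by rewrite /Q skewpoly_mulC monicE lead_coefZ mulVf.
have TE : T = (c'%:P : skewpoly (@sigma F L)) * Q.
  by rewrite /Q !skewpoly_mulC scalerA mulfV // scale1r.
have [|qs [qs_irr qsQ qs_deg]] := IHt Q c' _ Qm c'0 TE.
  by move=> g gt; apply: irr; rewrite inE gt orbT.
pose f1 := f * (c'%:P : skewpoly (@sigma F L)).
have c'P0 : (c'%:P : skewpoly (@sigma F L)) != 0 by rewrite polyC_eq0.
have f10 : f1 != 0 by apply: skewpoly_mul_neq0.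
pose b := lead_coef f1.
have b0 : b != 0 by rewrite lead_coef_eq0.
pose f2 := (b^-1%:P : skewpoly (@sigma F L)) * f1.
have f2m : (f2 : {poly L}) \is monic.
  by rewrite /f2 skewpoly_mulC monicE lead_coefZ mulVf.
have f2_irr : irreducible_elt f2.
  rewrite /f2 /f1 mulrA; apply: irreducible_eltMM.
  - by apply: is_unit_skewC; rewrite invr_eq0.
  - exact: is_unit_skewC.
  - by apply: irr; rewrite mem_head.
have f2_deg : deg f2 = deg f.
  rewrite /deg /f2 skewpoly_mulC size_scale ?invr_eq0 //.
  by rewrite skewpoly_prod_size // size_polyC c'0 addn1.
(* [f2 * Q] is a scalar multiple of [P] and both are monic, so the scalar is 1. *)
have f2Q : f2 * Q = P.
  have f2QE : f2 * Q = (b^-1 * c) *: (P : {poly L}).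
    rewrite /f2 /f1 -!mulrA -TE fT !skewpoly_mulC scalerA //.
  have /monicP := monic_skew_mul f2m Qm.
  by rewrite f2QE lead_coefZ (monicP Pm) mulr1 => ->; rewrite scale1r.
exists (f2 :: qs); split.
- by move=> g; rewrite inE => /predU1P[->|/qs_irr].
- by rewrite big_cons qsQ.
- by rewrite /= f2_deg qs_deg.
Qed.

(** * Unique factorization over a field and comparison of degrees *)

Lemma irreducible_dvdp_prod (F : fieldType) (f : {poly F}) (gs : seq {poly F}) :
    irreducible_poly f -> f %| \prod_(g <- gs) g ->
  exists2 g, g \in gs & f %| g.
Proof.
move=> f_irr; elim: gs => [|g gs IHgs].
  by rewrite big_nil dvdp1 => /eqP f1; case: f_irr; rewrite f1.
rewrite big_cons; have [fg _|nfg] := boolP (f %| g).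
  by exists g; rewrite ?mem_head.
rewrite Gauss_dvdpr ?irreducible_poly_coprime // => /IHgs[h hgs fh].
by exists h; rewrite // inE hgs orbT.
Qed.

(** The first factor is matched with an associate in [gs]. Products are compared up to [%=] because
    cancelling associates leaves a unit. *)
Lemma irreducible_factors_deg (F : fieldType) (fs gs : seq {poly F}) :
    (forall f, f \in fs -> irreducible_poly f) ->
    (forall g, g \in gs -> irreducible_poly g) ->
    \prod_(f <- fs) f %= \prod_(g <- gs) g ->
  perm_eq [seq deg f | f <- fs] [seq deg g | g <- gs].
Proof.
elim: fs gs => [|f fs IHfs] gs fs_irr gs_irr.
  rewrite big_nil; case: gs gs_irr => [|g gs] // gs_irr /eqp_dvdr e1.
  have := e1 g; rewrite big_cons dvdp_mulr // dvdp1 => /eqP g1.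
  by case: (gs_irr g (mem_head _ _)); rewrite g1.
have f_irr := fs_irr f (mem_head _ _).
have f0 : f != 0 by rewrite -size_poly_gt0 ltnW // f_irr.1.
rewrite big_cons => fsgs.
have [|g g_gs fg] := @irreducible_dvdp_prod _ f gs f_irr.
  by rewrite -(eqp_dvdr _ fsgs) dvdp_mulr.
have f_eq_g : f %= g.
  by apply: (gs_irr g g_gs).2 fg; rewrite neq_ltn f_irr.1 orbT.
have perm_gs := perm_to_rem g_gs.
rewrite perm_sym; apply: perm_trans (perm_map _ perm_gs) _; rewrite perm_sym /=.
have -> : deg f = deg g by rewrite /deg (eqp_size f_eq_g).
rewrite perm_cons; apply: IHfs.
- by move=> h h_fs; apply: fs_irr; rewrite inE h_fs orbT.
- by move=> h /mem_rem; apply: gs_irr.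
rewrite -(eqp_mul2l _ _ f0); apply: eqp_trans fsgs _.
rewrite (perm_big _ perm_gs) big_cons /=.
by apply: eqp_mulr; rewrite eqp_sym.
Qed.

Theorem corollary2p4p9
  (p a r : nat) (p_prime : prime p) (a_gt0 : (0 < a)%N) (r_ge1 : (1 <= r)%N)
  (F : finFieldType) (cardF : #|F| = (p ^ a)%N)
  (L : fieldExtType F) (dimL : \dim {:L} = r)
  (P : skewpoly (@sigma F L)) (P_monic : (P : {poly L}) \is monic)
  (ps : seq (skewpoly (@sigma F L)))
  (ps_irr : forall f, f \in ps -> irreducible_elt f)
  (ps_prod : \prod_(f <- ps) f = P)
  (gs : seq {poly F})
  (gs_irr : forall g, g \in gs -> irreducible_poly g)
  (gs_prod : \prod_(g <- gs) g = Psi P) :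
  perm_eq [seq deg f | f <- ps] [seq deg g | g <- gs].
Proof.
(* The factors in [ps] need not be monic; monic ones of the same degrees replace them so that [Psi]
   applies factor by factor. *)
have [|qs [qs_irr qs_prod <-]] := monic_skew_factorization ps_irr P_monic (oner_neq0 L).
  by rewrite ps_prod; apply/esym/mul1r.
have [Pm PsiE] : (\prod_(f <- qs) f : {poly L}) \is monic /\
    Psi (\prod_(f <- qs) f) = \prod_(f <- qs) Psi f.
  elim: qs qs_irr {qs_prod} => [|f qs IHqs] irr.
    rewrite !big_nil; split; first exact: monic1.
    apply: (map_poly_inj (in_alg L)); rewrite map_Psi rmorph1 /PsiL.
    (* For the empty product D_P is zero, and the characteristic polynomial is an empty
       determinant. *)
    have char_poly_dim0 d (M : 'M[L]_d) : d = 0%N -> char_poly M = 1.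
      by case: d M => // M _; apply: det_mx00.
    by apply: char_poly_dim0; rewrite /deg size_poly1.
  have [|qs_m qsE] := IHqs; first by move=> g g_qs; apply: irr; rewrite inE g_qs orbT.
  have [fm f_irr] := irr f (mem_head _ _).
  rewrite !big_cons Psi_mul ?qsE //; first by split=> //; apply: monic_skew_mul.
  exact: irreducible_deg_gt0 (monic_neq0 fm) f_irr.
(* [Psi] preserves degrees, so it remains to compare two irreducible factorizations of [Psi P]. *)
have -> : [seq deg f | f <- qs] = [seq deg g | g <- [seq Psi f | f <- qs]].
  by rewrite -map_comp; apply: eq_map => f; rewrite /= /deg size_Psi.
apply: irreducible_factors_deg gs_irr _.
  by move=> _ /mapP[f /qs_irr[fm f_irr] ->]; apply: Psi_irreducible.
by rewrite gs_prod -qs_prod PsiE big_map eqpxx.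
Qed.
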